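(* Let $k$ be a positive integer. For integers $q\ge 2$ define \[ f_k(q) = \min \{ |A-A| : A\subset \mathbb{Z}_q,\ kA = \mathbb{Z}_q \}, \] \[ g_k(q) = \min \{ |A-A| : A\subset \mathbb{Z} \text{ finite},\ kA \supset \{a+1, \ldots, a+q \} \text{ for some integer } a \}, \] \[ h_k(q) = \min \{ |A-A| : A\subset \mathbb{Z} \text{ finite},\ |kA| \geq q \}, \] and put $\beta_k = \inf_{q\geq 2} \frac{\log g_k(q)}{\log q}$. Then the limits as $q\to\infty$ of $\frac{\log f_k(q)}{\log q}$, $\frac{\log g_k(q)}{\log q}$, $\frac{\log h_k(q)}{\log q}$ exist and \[ \lim_{q\to\infty} \frac{\log f_k(q)}{\log q} = \lim_{q\to\infty} \frac{\log g_k(q)}{\log q} = \lim_{q\to\infty} \frac{\log h_k(q)}{\log q} = \inf_{q\geq 2} \frac{\log h_k(q)}{\log q} = \beta_k. \]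
   Context: $\mathbb{Z}_q$ denotes the group of residues modulo $q$. For a set $A$ in an abelian group, $kA = A+\cdots+A$ ($k$ times) is the set of all sums of $k$ elements of $A$, and $A-A=\{a-b: a,b\in A\}$. *)

(* Defs.v *)
From mathcomp Require Import all_boot all_order all_algebra finmap.
From mathcomp Require Import all_classical all_reals all_analysis.
Set Implicit Arguments.
Unset Strict Implicit.
Unset Printing Implicit Defensive.
Import Order.TTheory GRing.Theory Num.Theory.
Import numFieldNormedType.Exports.
Local Open Scope fset_scope.
Local Open Scope classical_set_scope.
Local Open Scope ring_scope.

Definition sumset (V : zmodType) (A B : {fset V}) : {fset V} :=
  [fset a + b | a in A, b in B].

Definition ksumset (V : zmodType) (k : nat) (A : {fset V}) : {fset V} :=
  iter k (sumset A) [fset 0].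

Definition diffset (V : zmodType) (A : {fset V}) : {fset V} :=
  [fset a - b | a in A, b in A].

(* The least element of S, with the junk value 0 when S is empty; which
   never occurs below for k > 0: see [f_set_nonempty] and its analogues. *)
Definition min_nat (S : set nat) : nat :=
  xget 0%N [set m | S m /\ forall n, S n -> (m <= n)%N].

Lemma min_natP (S : set nat) : S !=set0 ->
  S (min_nat S) /\ forall n, S n -> (min_nat S <= n)%N.
Proof.
case=> n0 Sn0; rewrite /min_nat; apply: (@xgetPex _ 0%N
  [set m | S m /\ forall n, S n -> (m <= n)%N]).
have ex : exists n, `[< S n >] by exists n0; apply/asboolP.
case: (ex_minnP ex) => m /asboolP Sm mmin.
by exists m; split=> // n Sn; apply: mmin; apply/asboolP.
Qed.

(* For q >= 2 the type 'Z_q is the group of residues modulo q; the values of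
   [f_] at q = 0, 1 are irrelevant. *)
Definition f_set (k q : nat) : set nat :=
  [set #|` diffset A| | A in
     [set A : {fset 'Z_q} | forall x : 'Z_q, x \in ksumset k A]].

Definition g_set (k q : nat) : set nat :=
  [set #|` diffset A| | A in
     [set A : {fset int} | exists a : int,
        forall i : nat, (1 <= i <= q)%N -> a + i%:Z \in ksumset k A]].

Definition h_set (k q : nat) : set nat :=
  [set #|` diffset A| | A in
     [set A : {fset int} | (q <= #|` ksumset k A|)%N]].

Definition f_ (k q : nat) : nat := min_nat (f_set k q).
Definition g_ (k q : nat) : nat := min_nat (g_set k q).
Definition h_ (k q : nat) : nat := min_nat (h_set k q).

Definition log_ratio (R : realType) (u : nat -> nat) (q : nat) : R :=
  ln (u q)%:R / ln q%:R.

Definition inf_ge2 (R : realType) (u : nat -> R) : R :=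
  inf [set u q | q in [set q | (2 <= q)%N]].

Definition beta_ (R : realType) (k : nat) : R := inf_ge2 (log_ratio R (g_ k)).

Lemma mem_sumset (V : zmodType) (A B : {fset V}) (a b : V) :
  a \in A -> b \in B -> a + b \in sumset A B.
Proof. by move=> aA bB; apply/imfset2P; exists a => //; exists b. Qed.

Lemma ksumset0 (V : zmodType) (k : nat) (A : {fset V}) :
  0 \in A -> 0 \in ksumset k A.
Proof.
move=> A0; elim: k => [|k IH]; first by rewrite /ksumset /= inE.
by rewrite -[0]addr0; exact: mem_sumset.
Qed.

Lemma sub_ksumset (V : zmodType) (k : nat) (A : {fset V}) (x : V) :
  (0 < k)%N -> 0 \in A -> x \in A -> x \in ksumset k A.
Proof.
by case: k => // k _ A0 xA; rewrite -[x]addr0; apply/mem_sumset/ksumset0.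
Qed.

Lemma f_set_nonempty (k q : nat) : (0 < k)%N -> f_set k q !=set0.
Proof.
move=> k0; pose A : {fset 'Z_q} := [fset x | x in 'Z_q].
have AT x : x \in A by apply/imfsetP; exists x.
by exists #|` diffset A|, A => //= x; apply: sub_ksumset.
Qed.

Definition iotaz (q : nat) : {fset int} := [fset i%:Z | i in iota 0 q.+1].

Lemma mem_iotaz (q i : nat) : (i <= q)%N -> i%:Z \in iotaz q.
Proof. move=> iq; apply/imfsetP; exists i => //=.
by have := mem_iota 0 q.+1 i; rewrite add0n ltnS iq. Qed.

Lemma g_set_nonempty (k q : nat) : (0 < k)%N -> g_set k q !=set0.
Proof.
move=> k0; exists #|` diffset (iotaz q)|, (iotaz q) => //=.
exists 0 => i /andP[_ iq]; rewrite add0r.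
by apply: sub_ksumset => //; [exact: (@mem_iotaz q 0) | exact: mem_iotaz].
Qed.

Lemma h_set_nonempty (k q : nat) : (0 < k)%N -> h_set k q !=set0.
Proof.
move=> k0; exists #|` diffset (iotaz q)|, (iotaz q) => //=.
have sub : (iotaz q `<=` ksumset k (iotaz q))%fset.
  apply/fsubsetP => x; apply: sub_ksumset => //; exact: (@mem_iotaz q 0).
apply: leq_trans (fsubset_leq_card sub).
rewrite card_imfset; last by move=> i j [].
change (q <= size (undup (iota 0 q.+1)))%N.
by rewrite (undup_id (iota_uniq 0 q.+1)) size_iota.
Qed.

Lemma log_ratio_ge0 (R : realType) (u : nat -> nat) (q : nat) :
  0 <= log_ratio R u q.
Proof.
have ln0 n : 0 <= ln (n%:R : R).
  by case: n => [|n]; [rewrite ln0 | rewrite ln_ge0 // ler1n].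
by rewrite /log_ratio mulr_ge0 // invr_ge0.
Qed.

Lemma has_inf_log_ratio (R : realType) (u : nat -> nat) :
  has_inf [set log_ratio R u q | q in [set q | (2 <= q)%N]].
Proof.
split; first by exists (log_ratio R u 2), 2%N.
by exists 0 => _ [q _ <-]; exact: log_ratio_ge0.
Qed.

(* Main.v *)
(* Reducing modulo q gives f <= g; conversely a basis A of Z_q, lifted to
   [0, q) and translated by 0, -q, ..., -(k-1)q, gives g <= 2k^2 f. Digit
   expansions give g(qr) <= g(q) g(r), so log g / log q tends to its infimum,
   and everything reduces to: beta log |kA| <= log |A - A| for finite A in Z.
   For a large prime p let |kA|^m be about p / 2. The power A^m in Z^m is
   projected to Z_p by a random linear form; a collision count shows that some
   form keeps half of the points of (kA)^m, so the image B of A^m satisfies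
   |kB| >= |kA|^m / 2, of order p, while |B - B| <= |A - A|^m. Greedily
   O(m) translates T of kB cover Z_p, and B + (T u {0}) shows that
   f(p) <= |A - A|^m O(m^2). Let m tend to infinity. *)
Require Import Defs.
From mathcomp Require Import all_boot all_order all_algebra finmap.
From mathcomp Require Import all_classical all_reals all_analysis.
From mathcomp Require Import zify ring lra.
Import Order.TTheory GRing.Theory Num.Theory.
Import numFieldNormedType.Exports.
Set Implicit Arguments.
Unset Strict Implicit.
Local Open Scope ring_scope.

(** * Sumsets *)

Lemma sumsetP (V : zmodType) (A B : {fset V}) (x : V) :
  reflect (exists a b, [/\ a \in A, b \in B & x = a + b]) (x \in sumset A B).
Proof.
apply: (iffP idP) => [/imfset2P[a aA [b bB ->]]|[a [b [aA bB ->]]]].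
  by exists a, b.
by apply/imfset2P; exists a => //; exists b.
Qed.

Lemma diffsetP (V : zmodType) (A : {fset V}) (x : V) :
  reflect (exists a b, [/\ a \in A, b \in A & x = a - b]) (x \in diffset A).
Proof.
apply: (iffP idP) => [/imfset2P[a aA [b bA ->]]|[a [b [aA bA ->]]]].
  by exists a, b.
by apply/imfset2P; exists a => //; exists b.
Qed.

Lemma ksumsetS (V : zmodType) (k : nat) (A : {fset V}) :
  ksumset k.+1 A = sumset A (ksumset k A).
Proof. by []. Qed.

Lemma leq_card_imfset (T U : choiceType) (f : T -> U) (A : {fset T}) :
  (#|` [fset f x | x in A]%fset| <= #|` A|)%N.
Proof. exact: leq_imfset_card. Qed.

Lemma leq_card_imfset2 (T : choiceType) (op : T -> T -> T) (A B : {fset T}) :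
  (#|` [fset op a b | a in A, b in B]%fset| <= #|` A| * #|` B|)%N.
Proof.
rewrite -(size_allpairs op A B); set s := [seq _ | _ <- _, _ <- _].
rewrite -(undup_id (fset_uniq _)); apply: uniq_leq_size (undup_uniq _) _ => x.
rewrite mem_undup => /imfset2P[a aA [b bB ->]]; exact: allpairs_f.
Qed.

Lemma leq_card_sumset (V : zmodType) (A B : {fset V}) :
  (#|` sumset A B| <= #|` A| * #|` B|)%N.
Proof. exact: leq_card_imfset2. Qed.

Lemma leq_card_diffset (V : zmodType) (A : {fset V}) :
  (#|` diffset A| <= #|` A| ^ 2)%N.
Proof. by rewrite -mulnn; exact: (leq_card_imfset2 (fun a b => a - b)). Qed.

(** Since (a + b) - (c + d) = (a - c) + (b - d), differences of A + B lie in (A - A) + (B - B). All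
    constructions below are sums of sets, and this bounds their cost. *)
Lemma leq_card_diffset_sumset (V : zmodType) (A B : {fset V}) :
  (#|` diffset (sumset A B)| <= #|` diffset A| * #|` diffset B|)%N.
Proof.
apply: leq_trans (leq_card_sumset _ _); apply/fsubset_leq_card/fsubsetP => x.
move=> /diffsetP[_ [_ [/sumsetP[a [b [aA bB ->]]] /sumsetP[c [d [cA dB ->]]] ->]]].
rewrite opprD addrACA.
by apply: mem_sumset; apply/diffsetP; [exists a, c | exists b, d].
Qed.

Lemma sumset_ksumset (V : zmodType) (k : nat) (A B : {fset V}) (a b : V) :
  a \in ksumset k A -> b \in ksumset k B -> a + b \in ksumset k (sumset A B).
Proof.
elim: k a b => [|k IH] a b; first by rewrite !inE => /eqP-> /eqP->; rewrite addr0.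
rewrite !ksumsetS => /sumsetP[a1 [a2 [a1A a2A ->]]] /sumsetP[b1 [b2 [? ? ->]]].
by rewrite addrACA; apply: mem_sumset; [exact: mem_sumset | exact: IH].
Qed.

Lemma ksumset_sub (V : zmodType) (k : nat) (A B : {fset V}) :
  {subset A <= B} -> {subset ksumset k A <= ksumset k B}.
Proof.
move=> AB; elim: k => // k IH x /sumsetP[a [b [aA bA ->]]].
by apply: mem_sumset; [exact: AB | exact: IH].
Qed.

(** * Images under additive maps *)

Section Image.
Variables (V W : zmodType) (f : V -> W).
Hypothesis fB : {morph f : x y / x - y}.

Let f0 : f 0 = 0. Proof. by rewrite -(subr0 0) fB subrr. Qed.
Let fD : {morph f : x y / x + y}.
Proof. by move=> x y; rewrite -{1}(opprK y) -(sub0r y) !fB f0 sub0r opprK. Qed.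

Lemma ksumset_imfset (k : nat) (A : {fset V}) :
  ksumset k [fset f x | x in A]%fset = [fset f x | x in ksumset k A]%fset.
Proof.
elim: k => [|k IH]; first by rewrite imfset_fset1 f0.
apply/fsetP => y; rewrite !ksumsetS IH; apply/sumsetP/imfsetP.
  move=> [_ [_ [/imfsetP[a aA ->] /imfsetP[b bA ->] ->]]].
  by exists (a + b); [exact: mem_sumset | rewrite fD].
move=> [_ /sumsetP[a [b [aA bA ->]]] ->]; exists (f a), (f b).
by split; rewrite ?fD// in_imfset.
Qed.

Lemma leq_card_diffset_imfset (A : {fset V}) :
  (#|` diffset [fset f x | x in A]%fset| <= #|` diffset A|)%N.
Proof.
apply: (leq_trans _ (leq_card_imfset f _)).
apply/fsubset_leq_card/fsubsetP => x.
move=> /diffsetP[_ [_ [/imfsetP[a aA ->] /imfsetP[b bA ->] ->]]].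
apply/imfsetP; exists (a - b); last by rewrite fB.
by apply/diffsetP; exists a, b.
Qed.

End Image.

(** * Sums of indexed families, modelling images of products under linear forms *)

Section BigSumset.
Variables (V : zmodType) (I : finType).

Lemma mem_big_sumset (F : I -> {fset V}) (x : I -> V) :
  (forall i, x i \in F i) ->
  \sum_i x i \in \big[@sumset V/[fset 0]%fset]_i F i.
Proof.
move=> xF; elim/big_rec2: _ => [|i B s _ IH]; first by rewrite inE.
exact: mem_sumset.
Qed.

Lemma leq_card_diffset_big_sumset (F : I -> {fset V}) :
  (#|` diffset (\big[@sumset V/[fset 0%R]%fset]_i F i)|
     <= \prod_i #|` diffset (F i)|)%N.
Proof.
apply: (big_rec2 (fun B N => (#|` diffset B| <= N)%N)) => [|i B N _ IH].
  by apply: leq_trans (leq_card_diffset _) _; rewrite cardfs1.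
by apply: leq_trans (leq_card_diffset_sumset _ _) _; rewrite leq_mul2l IH orbT.
Qed.

Lemma big_sumset_ksumset (k : nat) (F : I -> {fset V}) :
  {subset \big[@sumset V/[fset 0]%fset]_i ksumset k (F i) <=
     ksumset k (\big[@sumset V/[fset 0]%fset]_i F i)}.
Proof.
elim/big_rec2: _ => [|i X Y _ IH] x.
  by rewrite inE => /eqP->; apply: ksumset0; rewrite inE.
by move=> /sumsetP[a [b [aF bY ->]]]; apply: sumset_ksumset => //; exact: IH.
Qed.

End BigSumset.

Lemma min_nat_mem (S : set nat) : (S !=set0)%classic -> S (min_nat S).
Proof. by move=> /min_natP[]. Qed.

Lemma min_nat_le (S : set nat) (n : nat) : S n -> (min_nat S <= n)%N.
Proof.
move=> Sn; have S0 : (S !=set0)%classic by exists n.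
by have [_] := min_natP S0; exact.
Qed.

(** * Comparison of f, g and h *)

Lemma g_le (k q : nat) (A : {fset int}) (a : int) :
  (forall i : nat, (1 <= i <= q)%N -> a + i%:Z \in ksumset k A) ->
  (g_ k q <= #|` diffset A|)%N.
Proof. by move=> aA; apply: min_nat_le; exists A => //; exists a. Qed.

Lemma g_attained (k q : nat) : (0 < k)%N -> exists (A : {fset int}) (a : int),
  (forall i : nat, (1 <= i <= q)%N -> a + i%:Z \in ksumset k A) /\
  #|` diffset A| = g_ k q.
Proof.
by move=> k0; have [A [a aA] gA] := min_nat_mem (g_set_nonempty q k0); exists A, a.
Qed.

Lemma f_le (k q : nat) (A : {fset 'Z_q}) :
  (forall x, x \in ksumset k A) -> (f_ k q <= #|` diffset A|)%N.
Proof. by move=> kA; apply: min_nat_le; exists A. Qed.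

Lemma f_attained (k q : nat) : (0 < k)%N -> exists A : {fset 'Z_q},
  (forall x, x \in ksumset k A) /\ #|` diffset A| = f_ k q.
Proof.
by move=> k0; have [A kA fA] := min_nat_mem (f_set_nonempty q k0); exists A.
Qed.

Lemma h_attained (k q : nat) : (0 < k)%N -> exists A : {fset int},
  (q <= #|` ksumset k A|)%N /\ #|` diffset A| = h_ k q.
Proof.
by move=> k0; have [A kA hA] := min_nat_mem (h_set_nonempty q k0); exists A.
Qed.

Lemma g_mono (k q r : nat) : (0 < k)%N -> (q <= r)%N -> (g_ k q <= g_ k r)%N.
Proof.
move=> k0 qr; have [A [a [aA <-]]] := g_attained r k0.
by apply: (@g_le _ _ _ a) => i /andP[i1 iq]; rewrite aA // i1 (leq_trans iq).
Qed.

(** Base q expansion: A supplies the low digit and the dilate q B the high digit. *)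
Lemma g_mul (k q r : nat) : (0 < k)%N -> (0 < q)%N ->
  (g_ k (q * r) <= g_ k q * g_ k r)%N.
Proof.
move=> k0 q0.
have [A [a [aA <-]]] := g_attained q k0; have [B [b [bB <-]]] := g_attained r k0.
have mB : {morph (fun x : int => q%:Z * x) : x y / x - y}.
  by move=> x y; rewrite mulrBr.
set B' := [fset q%:Z * x | x in B]%fset.
apply: (@leq_trans (#|` diffset A| * #|` diffset B'|)%N); last first.
  by rewrite leq_mul2l (leq_card_diffset_imfset mB) orbT.
apply: leq_trans (leq_card_diffset_sumset _ _).
(* Both given intervals start at offset 1, so the digits j and s of i - 1 enter as j + 1 and s + 1;
   the extra q in the base point absorbs the shift of j. *)
apply: (@g_le _ _ _ (a + q%:Z * b + q%:Z)) => i /andP[i1 iq].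
pose j := (i.-1 %/ q)%N; pose s := (i.-1 %% q)%N.
have jr : (j < r)%N by rewrite ltn_divLR // mulnC; lia.
have sq : (s < q)%N by rewrite ltn_mod.
have ij : i = (j * q + s).+1 by rewrite -divn_eq; lia.
have -> : a + q%:Z * b + q%:Z + i%:Z = (a + s.+1%:Z) + q%:Z * (b + j.+1%:Z).
  by rewrite ij; lia.
apply: sumset_ksumset; first by apply: aA; lia.
rewrite (ksumset_imfset mB); apply/imfsetP; exists (b + j.+1%:Z) => //=.
by apply: bB; lia.
Qed.

Lemma g_exp (k q m : nat) : (0 < k)%N -> (0 < q)%N ->
  (g_ k (q ^ m.+1) <= g_ k q ^ m.+1)%N.
Proof.
move=> k0 q0; elim: m => // m IH; rewrite expnS (leq_trans (g_mul _ k0 q0)) //.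
by rewrite [(g_ k q ^ _)%N]expnS leq_mul2l IH orbT.
Qed.

Lemma h_le_g (k q : nat) : (0 < k)%N -> (h_ k q <= g_ k q)%N.
Proof.
move=> k0; have [A [a [aA <-]]] := g_attained q k0; apply: min_nat_le.
exists A => //=; rewrite -[X in (X <= _)%N](size_iota 1).
rewrite -(size_map (fun i : nat => a + i%:Z)); apply: uniq_leq_size.
  by rewrite map_inj_uniq ?iota_uniq // => i j /addrI[].
by move=> _ /mapP[i + ->]; rewrite mem_iota => iq; apply: aA; lia.
Qed.

(** * Passing between the integers and residues *)

Definition residue (q : nat) (x : int) : 'Z_q := x%:~R.

Lemma residueB (q : nat) : {morph @residue q : x y / x - y}.
Proof. by move=> x y; rewrite /residue intrB. Qed.

Lemma f_le_g (k q : nat) : (0 < k)%N -> (1 < q)%N -> (f_ k q <= g_ k q)%N.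
Proof.
move=> k0 q1; have [A [a [aA <-]]] := g_attained q k0.
apply: leq_trans (leq_card_diffset_imfset (@residueB q) A).
apply: f_le => x; rewrite (ksumset_imfset (@residueB q)); apply/imfsetP.
(* The representative of y in [0, q) says how far beyond a + 1 the interval meets the class x. *)
pose y : 'Z_q := x - residue q (a + 1).
have yq : (y < q)%N by rewrite -[X in (_ < X)%N](Zp_cast q1).
exists (a + (nat_of_ord y).+1%:Z); first by apply: aA; lia.
have -> : a + (nat_of_ord y).+1%:Z = (a + 1) + (nat_of_ord y)%:Z by lia.
rewrite /residue intrD -[(nat_of_ord y)%:Z%:~R]/((nat_of_ord y)%:R : 'Z_q) natr_Zp /y.
by rewrite addrC subrK.
Qed.

(** Lift A to representatives in [0, q). A sum of k of them is at most k(q - 1), so subtracting q j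
    for some j < k brings it into [0, q). The set C of these translates costs k^2, and lifting A - A
    costs the factor 2. *)
Lemma g_le_f (k q : nat) : (0 < k)%N -> (1 < q)%N ->
  (g_ k q <= 2 * k ^ 2 * f_ k q)%N.
Proof.
move=> k0 q1; have [A [kA <-]] := f_attained q k0.
pose A' := [fset (nat_of_ord x)%:Z | x in A]%fset.
pose C := [fset - (q * j)%:Z | j in iota 0 k]%fset.
have Zq (x : 'Z_q) : (x < q)%N by rewrite -[X in (_ < X)%N](Zp_cast q1).
have res_val (x : 'Z_q) : residue q (nat_of_ord x)%:Z = x by exact: natr_Zp.
have cardC : (#|` diffset C| <= k ^ 2)%N.
  apply: leq_trans (leq_card_diffset _) _; rewrite leq_sqr.
  apply: leq_trans (leq_imfset_card _ _ _) _ => /=.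
  by rewrite (undup_id (iota_uniq 0 k)) size_iota.
(* The difference of two representatives is the representative of the difference, or that minus
   q. *)
have cardA' : (#|` diffset A'| <= #|` diffset A| * 2)%N.
  pose D := [fset (nat_of_ord x)%:Z | x in diffset A]%fset.
  apply: (@leq_trans #|` sumset D [fset 0; - q%:Z]%fset|); last first.
    apply: leq_trans (leq_card_sumset _ _) _; rewrite cardfs2; apply: leq_mul.
      exact: leq_card_imfset.
    by case: (_ != _).
  apply/fsubset_leq_card/fsubsetP => x.
  move=> /diffsetP[_ [_ [/imfsetP[a aA ->] /imfsetP[b bA ->] ->]]].
  have abD : (nat_of_ord (a - b))%:Z \in D.
    by apply/imfsetP; exists (a - b) => //; apply/diffsetP; exists a, b.
  have : (nat_of_ord (a - b)%R = if b <= a then a - b else q + a - b :> nat)%N.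
    (* The modulus built into ['Z_q] is [(Zp_trunc q).+2]; naming it n allows its replacement by
       q. *)
    have vE n : n = (Zp_trunc q).+2 ->
      nat_of_ord (a - b)%R = ((a + (n - b) %% n) %% n)%N by move=> ->.
    rewrite (vE q) ?Zp_cast // modnDmr; case: ifP => ba.
      have -> : (a + (q - b) = q + (a - b))%N by have := Zq b; lia.
      by rewrite modnDl modn_small //; have := Zq a; lia.
    by rewrite modn_small; have := Zq a; have := Zq b; lia.
  case: ifP => ba eqab.
    rewrite (_ : _ - _ = (nat_of_ord (a - b))%:Z + 0); last by rewrite eqab /=; lia.
    by apply: mem_sumset => //; rewrite !inE eqxx.
  rewrite (_ : _ - _ = (nat_of_ord (a - b))%:Z + - q%:Z).
    by apply: mem_sumset => //; rewrite !inE eqxx orbT.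
  by rewrite eqab /=; have := Zq a; have := Zq b; lia.
apply: (@leq_trans #|` diffset (sumset A' C)|); last first.
  apply: leq_trans (leq_card_diffset_sumset _ _) _.
  by apply: leq_trans (leq_mul cardA' cardC) _; rewrite -mulnA mulnC.
have A'le n x : x \in ksumset n A' -> 0 <= x <= (n * q.-1)%:Z.
  elim: n x => [|n IH] x; first by rewrite inE mul0n => /eqP->.
  move=> /sumsetP[_ [b [/imfsetP[a aA ->] /IH bb ->]]].
  by have := Zq a; rewrite /=; lia.
(* With base point -1 the target interval is exactly [0, q). *)
apply: (@g_le _ _ _ (-1)) => i /andP[i1 iq].
have /imfsetP[s sA' rs] : residue q (- 1 + i%:Z) \in
    [fset residue q x | x in ksumset k A']%fset.
  rewrite -(ksumset_imfset (@residueB q)); apply: (ksumset_sub _ (kA _)) => x xA.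
  by rewrite -(res_val x); do 2 apply: in_imfset.
have /andP[s0 sk] := A'le _ _ sA'.
have iE : - 1 + i%:Z = i.-1%:Z by lia.
have sE : s = (`|s|%N)%:Z by lia.
have smod : (`|s| %% q)%N = i.-1.
  have : (i.-1%:R : 'Z_q) = `|s|%:R.
    by rewrite iE [in RHS]sE in rs; exact: rs.
  move=> /(congr1 (@nat_of_ord _)); rewrite !val_Zp_nat // => <-.
  by rewrite modn_small; lia.
pose j := (`|s| %/ q)%N.
have sj := divn_eq `|s| q; rewrite -/j smod in sj.
have jk : (j < k)%N by rewrite ltn_divLR //; nia.
have -> : - 1 + i%:Z = s + - (q * j)%:Z by rewrite iE sE sj; lia.
apply: sumset_ksumset => //; apply: sub_ksumset => //.
  by apply/imfsetP; exists 0%N; rewrite ?muln0 ?oppr0 //= mem_iota.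
by apply/imfsetP; exists j => //=; rewrite mem_iota.
Qed.

(** * Random projections and greedy covering *)

(** The first-moment method; it selects both the linear form and each greedy translate. *)
Lemma exists_leq_of_sum (T : finType) (F G : T -> nat) :
  (0 < #|T|)%N -> (\sum_x F x <= \sum_x G x)%N -> exists x, (F x <= G x)%N.
Proof.
move=> /card_gt0P[x0 _] le_sum; apply/not_existsP => lt_GF; move: le_sum.
apply/negP; rewrite -ltnNge (bigD1 x0) //= [X in (_ < X)%N](bigD1 x0) //= -addSn.
apply: leq_add; first by rewrite ltnNge; apply/negP/lt_GF.
by apply: leq_sum => x _; rewrite leqNgt; apply/negP => /ltnW/lt_GF.
Qed.

(** Points that are not the first component of a colliding pair have distinct images; the others
    number at most the colliding pairs. *)
Lemma leq_card_image_collisions (X : finType) (Y : eqType) (f : X -> Y) (s : seq Y) :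
  (forall x, f x \in s) ->
  (#|X| <= size s + #|[set u : X * X | (u.1 != u.2) && (f u.1 == f u.2)]|)%N.
Proof.
set P := finset _ => fs.
have -> : #|X| = (#|~: [set u.1 | u in P]| + #|[set u.1 | u in P]|)%N.
  by rewrite addnC cardsC.
apply: leq_add; last exact: leq_imset_card.
rewrite cardE -(size_map f); apply: uniq_leq_size; last by move=> _ /mapP[x _ ->].
rewrite map_inj_in_uniq ?enum_uniq // => x y; rewrite !mem_enum => xP _ fxy.
apply/eqP/negPn/negP => xy; move: xP; rewrite inE => /negP; apply.
by apply/imsetP; exists (x, y) => //; rewrite inE /= xy fxy /=.
Qed.

(** * Random linear forms with few collisions *)

Section Projection.
Variables (m N : nat) (K : {fset int}).
Hypothesis N_gt1 : (1 < N)%N.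
Hypothesis K_unit : forall x y, x \in K -> y \in K -> x != y ->
  residue N (x - y) \is a GRing.unit.

Local Notation point := {ffun 'I_m -> K}.

Let proj (l : {ffun 'I_m -> 'Z_N}) (x : point) : 'Z_N :=
  \sum_i l i * residue N (val (x i)).

Let card_ZN : #|'Z_N| = N. Proof. by rewrite card_ord Zp_cast. Qed.

(* Adding c to the i-th coordinate of l, where x i <> y i, shifts the
   difference of the two projections by a unit multiple of c, so the set of
   colliding l has N disjoint translates. *)
Lemma card_collision (x y : point) : x != y ->
  (N * #|[set l | proj l x == proj l y]| <= N ^ m)%N.
Proof.
move=> xy; have [i xyi] : exists i, x i != y i.
  apply/existsP; rewrite -negb_forall; apply: contra xy => /forallP exy.
  by apply/eqP/ffunP => i; apply/eqP/exy.
pose d := residue N (val (x i)) - residue N (val (y i)).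
have d_unit : d \is a GRing.unit.
  by rewrite /d -residueB K_unit ?fsvalP //; apply: contra xyi => /eqP/val_inj->.
pose shift (u : 'Z_N * {ffun 'I_m -> 'Z_N}) : {ffun 'I_m -> 'Z_N} :=
  [ffun j => u.2 j + (if j == i then u.1 else 0)].
have proj_shift u : proj (shift u) x - proj (shift u) y =
    proj u.2 x - proj u.2 y + u.1 * d.
  rewrite /proj -!sumrB (bigD1 i) //= [in RHS](bigD1 i) //= !ffunE eqxx.
  rewrite [in RHS]addrAC; congr (_ + _); first by rewrite /d !mulrDl mulrBr; ring.
  by apply: eq_bigr => j /negPf ji; rewrite !ffunE ji addr0.
set C := finset _.
have -> : (N ^ m)%N = #|{ffun 'I_m -> 'Z_N}| by rewrite card_ffun card_ZN card_ord.
rewrite -{1}card_ZN -cardsT -cardsX -(card_in_imset (f := shift)).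
  exact: max_card.
move=> [c l] [c' l']; rewrite !inE /= => /eqP lC /eqP l'C eql.
have := proj_shift (c, l); have := proj_shift (c', l').
rewrite eql /= lC l'C !subrr !add0r => -> /(mulIr d_unit) ecc.
congr (_, _) => //; apply/ffunP => j; move/ffunP: eql => /(_ j).
by rewrite !ffunE /= ecc => /addIr.
Qed.

(** Each pair of distinct points collides under at most a fraction 1/N of the forms. Hence some form
    has at most |K|^(2m) / N <= |K|^m / 2 collisions, which leaves at least half of the points as
    distinct images. *)
Lemma exists_large_projection : (2 * #|` K| ^ m <= N)%N ->
  exists l : 'I_m -> 'Z_N, (#|` K| ^ m <= 2 * #|` \big[@sumset 'Z_N/[fset 0%R]%fset]_i
     [fset (l i * residue N x)%R | x in K]%fset|)%N.
Proof.
have card_point : #|{: point}| = (#|` K| ^ m)%N.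
  by rewrite card_ffun card_ord cardfE.
move=> KN; pose coll l := #|[set u : point * point |
  (u.1 != u.2) && (proj l u.1 == proj l u.2)]|.
have card_l : #|{: {ffun 'I_m -> 'Z_N}}| = (N ^ m)%N.
  by rewrite card_ffun card_ZN card_ord.
have [l coll_l] : exists l, (N * coll l <= (#|` K| ^ m) ^ 2)%N.
  apply: exists_leq_of_sum; first by rewrite card_l expn_gt0 (ltnW N_gt1).
  rewrite -big_distrr sum_nat_const card_l /=.
  (* Double counting of the triples formed by a form and a pair it identifies. *)
  have -> : \sum_l coll l =
      \sum_(u : point * point | u.1 != u.2) #|[set l | proj l u.1 == proj l u.2]|.
    under eq_bigr => l _ do rewrite /coll -sum1dep_card big_mkcondr /=.
    rewrite exchange_big /=; apply: eq_bigr => u _.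
    by rewrite -big_mkcond sum1dep_card.
  rewrite big_distrr /= -card_point mulnC.
  apply: (@leq_trans (\sum_(u : point * point | u.1 != u.2) N ^ m)%N).
    by apply: leq_sum => u; exact: card_collision.
  rewrite sum_nat_const leq_mul2r -mulnn -card_prod; apply/orP; right.
  exact: max_card.
exists l; set S := \big[_/_]_i _.
have projS (x : point) : proj l x \in S.
  apply: (mem_big_sumset (F := fun i => [fset l i * residue N x | x in K]%fset)).
  by move=> i; apply/imfsetP; exists (val (x i)) => //; exact: fsvalP.
have : (#|` K| ^ m <= #|` S| + coll l)%N.
  by rewrite -card_point; exact: leq_card_image_collisions projS.
move: KN coll_l; set M := (_ ^ m)%N => KN coll_l.
have [->|M0] := posnP M; first by rewrite leq0n.
have : (2 * coll l <= M)%N; last by lia.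
by rewrite -(leq_pmul2l M0) mulnn (leq_trans _ coll_l)// mulnA leq_mul2r mulnC KN orbT.
Qed.

End Projection.

(** If U is the uncovered set, the translates S + x meet U in |U| |S| / |G| >= |U| / L points on
    average. So a well chosen translate shrinks U by a factor 1 - 1/L; the bound is stated with
    denominators cleared. *)
Lemma greedy_cover (G : finZmodType) (S : {fset G}) (L t : nat) :
  (#|G| <= L * #|` S|)%N -> exists T : {fset G}, (#|` T| <= t)%N /\
    (#|[set x | x \notin sumset S T]| * L ^ t <= #|G| * L.-1 ^ t)%N.
Proof.
move=> SL; elim: t => [|t [T [Tt UT]]].
  by exists fset0; rewrite cardfs0 !muln1 max_card.
set U := finset _ in UT.
have [x Ux] : exists x, (#|U| <= L * #|[set u in U | (u - x)%R \in S]|)%N.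
  apply: exists_leq_of_sum; first by apply/card_gt0P; exists 0.
  rewrite -big_distrr sum_nat_const /=.
  (* Each u lies in exactly |S| of the translates S + x. *)
  have -> : (\sum_x #|[set u in U | (u - x)%R \in S]| = #|U| * #|` S|)%N.
    under eq_bigr => x _ do rewrite -sum1dep_card big_mkcondr /=.
    rewrite exchange_big /= -sum_nat_const; apply: eq_bigr => u _.
    rewrite -big_mkcond sum1dep_card -(card_imset _ (@subrI G u)).
    rewrite -(card_uniqP (fset_uniq S)); apply: eq_card => y.
    apply/imsetP/idP => [[x]|yS]; first by rewrite inE => ? ->.
    by exists (u - y); rewrite ?inE subKr.
  by rewrite mulnCA mulnC leq_mul2l SL orbT.
exists (x |` T)%fset; split.
  by rewrite cardfsU1; case: (_ \notin _); lia.
set V := finset _.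
have VU : (#|V| + #|[set u in U | (u - x)%R \in S]| <= #|U|)%N.
  set W := [set u in U | _]; rewrite -(cardsID W U) addnC; apply: leq_add.
    by apply/subset_leq_card/fintype.subsetP => u; rewrite !inE => /andP[-> ->].
  apply/subset_leq_card/fintype.subsetP => u; rewrite !inE => uxT.
  have uT : u \notin sumset S T.
    apply: contra uxT => /sumsetP[s [y [sS yT ->]]].
    by apply: mem_sumset => //; rewrite in_fsetU yT orbT.
  rewrite uT andbT /=; apply: contra uxT => uxS.
  by rewrite -(subrK x u); apply: mem_sumset => //; rewrite fsetU11.
have LV : (L * #|V| <= L.-1 * #|U|)%N by nia.
apply: (@leq_trans (L.-1 * #|U| * L ^ t)).
  by rewrite expnS mulnCA mulnA leq_mul2r LV orbT.
by rewrite expnS mulnCA -mulnA leq_mul2l UT orbT.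
Qed.

(** L greedy steps halve the uncovered set. With a = L - 1, Bernoulli's inequality (1 + 1/a)^n >= 1
    + n/a at n = a + 1 gives more than 2. *)
Lemma leq_double_pred_expn (L : nat) : (0 < L)%N -> (2 * L.-1 ^ L <= L ^ L)%N.
Proof.
case: L => // a _ /=.
have bern n : ((a + n) * a ^ n <= a * a.+1 ^ n)%N.
  elim: n => [|n IH]; first by rewrite addn0.
  by rewrite !expnS; move: (_ ^ n)%N (_ ^ n)%N IH => x y IH; nia.
have [->|a0] := posnP a; first by rewrite exp0n.
rewrite -(leq_pmul2l a0); apply: leq_trans (bern a.+1).
by rewrite mulnA leq_mul2r; apply/orP; right; lia.
Qed.

(** * From integer sets to bases modulo a prime *)

Lemma residue_unit (p : nat) (z : int) : prime p -> z != 0 -> (`|z| < p)%N ->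
  residue p z \is a GRing.unit.
Proof.
move=> p_prime z0 zp; have p1 := prime_gt1 p_prime.
have cop : coprime p `|z|.
  by rewrite prime_coprime //; apply/negP => /dvdn_leq; lia.
case: z z0 zp cop => n z0 zp cop; rewrite /residue; first by rewrite unitZpE.
by rewrite NegzE mulrNz unitrN [_%:~R]/(n.+1%:R) unitZpE.
Qed.

(** The projection B of A^m satisfies |B - B| <= |A - A|^m and |kB| >= q^m / 2 >= p / (4q). Adding
    the few translates that make kB cover the group yields a basis; they account for the squared
    factor. *)
Lemma f_le_prime (k p m : nat) (A : {fset int}) :
  let q := #|` ksumset k A| in
  (0 < k)%N -> prime p ->
  (forall x y, x \in ksumset k A -> y \in ksumset k A -> (`|(x - y)%R| < p)%N) ->
  (2 * q ^ m <= p < 2 * q ^ m.+1)%N ->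
  (f_ k p <= #|` diffset A| ^ m * (8 * q ^ 2 * m.+1).+1 ^ 2)%N.
Proof.
move=> q k0 p_prime diam /andP[qp pq]; have p1 := prime_gt1 p_prime.
have q0 : (0 < q)%N by rewrite lt0n; apply/eqP => q0; move: pq; rewrite q0 exp0n.
have K_unit x y : x \in ksumset k A -> y \in ksumset k A -> x != y ->
    residue p (x - y) \is a GRing.unit.
  by move=> xK yK xy; apply: residue_unit; rewrite ?subr_eq0 ?diam.
have [l] := exists_large_projection p1 K_unit qp.
pose dil i x : 'Z_p := l i * residue p x.
have dilB i : {morph dil i : x y / x - y}.
  by move=> x y; rewrite /dil residueB mulrBr.
pose B := \big[@sumset 'Z_p/[fset 0]%fset]_i [fset dil i x | x in A]%fset.
rewrite -/q -/(dil _) => qS.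
have {}qS : (q ^ m <= 2 * #|` ksumset k B|)%N.
  apply: leq_trans qS _; rewrite leq_mul2l; apply/orP; right.
  apply/fsubset_leq_card/fsubsetP => x xS; apply: big_sumset_ksumset.
  by under eq_bigr => i _ do rewrite (ksumset_imfset (dilB i)).
(* Chosen so that p < 2 q^(m+1) <= 2^s. Every 4q greedy steps halve the uncovered set, so 4q s steps
   leave less than one point. *)
pose s := (2 * q * m.+1)%N.
have pS : (#|'Z_p| <= (4 * q) * #|` ksumset k B|)%N.
  rewrite card_ord Zp_cast //; apply: leq_trans (ltnW pq) _.
  rewrite expnS (_ : 4 * q * _ = 2 * (q * (2 * #|` ksumset k B|)))%N; last by ring.
  by rewrite !leq_mul2l qS !orbT.
have [T [Tt UT]] := greedy_cover (4 * q * s) pS.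
have cover x : x \in sumset (ksumset k B) T.
  apply: contraT => xT; move: UT; apply: contraLR => _; rewrite -ltnNge.
  have p2s : (p < 2 ^ s)%N.
    apply: (leq_trans pq); apply: (@leq_trans (2 * (2 ^ q) ^ m.+1)).
      by rewrite leq_mul2l leq_exp2r // ltnW // ltn_expl.
    rewrite -expnM -expnS leq_exp2l //; rewrite /s; nia.
  apply: (@leq_trans ((4 * q) ^ (4 * q * s))); last first.
    by apply: leq_pmull; apply/card_gt0P; exists x; rewrite inE.
  rewrite card_ord Zp_cast // !(expnM _ (4 * q)).
  apply: (@leq_trans (2 ^ s * ((4 * q).-1 ^ (4 * q)) ^ s)).
    rewrite ltn_pmul2r //; rewrite !expn_gt0; apply/orP; left; lia.
  rewrite -expnMn leq_exp2r; last by rewrite /s; lia.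
  by apply: leq_double_pred_expn; lia.
(* With 0 adjoined, T is contained in k T0, so kB + T is contained in k(B + T0). *)
pose T0 := (0 |` T)%fset.
apply: (@leq_trans #|` diffset (sumset B T0)|).
  apply: f_le => x; have /sumsetP[b [c [bB cT ->]]] := cover x.
  by apply: sumset_ksumset => //; apply: sub_ksumset; rewrite // !inE ?eqxx ?cT ?orbT.
apply: leq_trans (leq_card_diffset_sumset _ _) _; apply: leq_mul.
  apply: leq_trans (leq_card_diffset_big_sumset _) _.
  rewrite -[X in (_ <= _ ^ X)%N]card_ord -prod_nat_const.
  by apply: leq_prod => i _; exact: leq_card_diffset_imfset (dilB i) _.
apply: leq_trans (leq_card_diffset _) _; rewrite leq_sqr /T0 cardfsU1.
rewrite (_ : 8 * q ^ 2 * m.+1 = 4 * q * s)%N; last by rewrite /s; ring.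
by case: (_ \notin _); rewrite ?add1n ?add0n // leqW.
Qed.

(** The prime p comes first, exceeding the diameter of kA and 2 q^m0; then m is read off as the
    integer logarithm of p / 2 in base q, which puts p in the window of [f_le_prime]. The loss C
    (m+1)^2 is only polynomial in m. *)
Lemma g_le_infinitely_often (k : nat) (A : {fset int}) :
  let q := #|` ksumset k A| in
  (0 < k)%N -> (1 < q)%N -> exists2 C : nat, (0 < C)%N &
  forall m0 : nat, exists m p : nat, [/\ (m0 <= m)%N, (1 < p)%N, (q ^ m <= p)%N &
    (g_ k p <= C * (#|` diffset A| ^ m * m.+1 ^ 2))%N].
Proof.
(* The factor 2 k^2 comes from [g_le_f], and 9 q^2 from 8 q^2 (m+1) + 1 <= 9 q^2 (m+1). *)
move=> q k0 q1; exists (2 * k ^ 2 * (9 * q ^ 2) ^ 2)%N.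
  by rewrite !(muln_gt0, expn_gt0) k0 (ltnW q1).
move=> m0; pose M := (\max_(u : ksumset k A * ksumset k A) `|(val u.1 - val u.2)%R|)%N.
have [p Mp p_prime] := prime_above (maxn M (2 * q ^ m0)).
have {Mp} [Mp qp] : (M < p)%N /\ (2 * q ^ m0 < p)%N by move: Mp; lia.
have p1 := prime_gt1 p_prime.
pose m := trunc_log q p./2; exists m, p.
have q_gt0 := ltnW q1.
have qm : (q ^ m <= p./2)%N by apply: trunc_logP => //; lia.
have qm1 : (p./2 < q ^ m.+1)%N by apply: trunc_log_ltn.
split => //.
- by apply: trunc_log_max => //; lia.
- lia.
apply: leq_trans (g_le_f k0 p1) _.
rewrite -[X in (_ <= X)%N]mulnA leq_mul2l; apply/orP; right.
apply: (@leq_trans (#|` diffset A| ^ m * (8 * q ^ 2 * m.+1).+1 ^ 2)).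
  apply: f_le_prime => // [x y xK yK|]; last by rewrite -/q; apply/andP; split; lia.
  apply: leq_ltn_trans Mp.
  exact: (leq_bigmax (F := fun u : ksumset k A * ksumset k A =>
    `|(val u.1 - val u.2)%R|%N) ([` xK]%fset, [` yK]%fset)).
rewrite [X in (_ <= X)%N]mulnCA leq_mul2l -expnMn leq_sqr; apply/orP; right.
by have : (0 < q ^ 2 * m.+1)%N; rewrite ?muln_gt0 ?expn_gt0 ?q_gt0 //; lia.
Qed.

(** * Growth exponents *)

Local Open Scope classical_set_scope.
Local Open Scope ring_scope.

(** * Logarithms of natural numbers and limits of log ratios *)

Section Logarithms.
Variable R : realType.
Implicit Types (m n : nat) (u v : nat -> nat).

Lemma ln_nat_ge0 n : 0 <= ln (n%:R : R).
Proof. by case: n => [|n]; [rewrite ln0 | rewrite ln_ge0 // ler1n]. Qed.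

Lemma ln_nat_gt0 n : (1 < n)%N -> 0 < ln (n%:R : R).
Proof. by move=> n1; rewrite ln_gt0 // ltr1n. Qed.

Lemma ler_ln_nat m n : (m <= n)%N -> ln (m%:R : R) <= ln n%:R.
Proof.
case: m => [_|m mn]; first by rewrite ln0 // ln_nat_ge0.
by rewrite ler_ln ?ler_nat // posrE ltr0n // (leq_trans _ mn).
Qed.

(** Equality can fail at a zero factor, because ln 0 = 0 by convention. *)
Lemma ln_natM_le m n : ln ((m * n)%:R : R) <= ln m%:R + ln n%:R.
Proof.
case: m => [|m]; first by rewrite mul0n ln0 // add0r ln_nat_ge0.
case: n => [|n]; first by rewrite muln0 ln0 // addr0 ln_nat_ge0.
by rewrite natrM lnM // posrE ltr0n.
Qed.

Lemma ln_natX m n : (0 < m)%N -> ln ((m ^ n)%:R : R) = n%:R * ln m%:R.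
Proof. by move=> m0; rewrite natrX lnXn ?ltr0n // mulr_natl. Qed.

Lemma ln_natX_le m n : ln ((m ^ n)%:R : R) <= n%:R * ln m%:R.
Proof.
elim: n => [|n IH]; first by rewrite ln1 mul0r.
by rewrite expnS -addn1 natrD mulrDl mul1r addrC (le_trans (ln_natM_le _ _)) ?lerD2l.
Qed.

Lemma cst_div_ln_cvg0 (c : R) : c / ln (n%:R : R) @[n --> \oo] --> (0 : R).
Proof.
apply/cvgrPdist_le => e e0; near=> n; rewrite sub0r normrN normrM normfV.
have n1 : (1 < n)%N by near: n; exists 2%N.
have ln0 := ln_nat_gt0 n1.
rewrite (gtr0_norm ln0) ler_pdivrMr // mulrC -ler_pdivrMr //.
rewrite -[X in X <= _]expRK ler_ln ?posrE ?expR_gt0 ?ltr0n ?(ltnW n1) //.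
by near: n; exact: nbhs_infty_ger.
Unshelve. all: by end_near. Qed.

Lemma inf_ge2_le u n : (1 < n)%N -> inf_ge2 (log_ratio R u) <= log_ratio R u n.
Proof.
move=> n1; apply: ge_inf; first by have [] := has_inf_log_ratio R u.
by exists n.
Qed.

Lemma le_inf_ge2 u (x : R) : (forall n, (1 < n)%N -> x <= log_ratio R u n) ->
  x <= inf_ge2 (log_ratio R u).
Proof.
move=> xu; apply: lb_le_inf; first by have [] := has_inf_log_ratio R u.
by move=> _ [n n1 <-]; exact: xu.
Qed.

Lemma le_log_ratio u v n : (u n <= v n)%N -> log_ratio R u n <= log_ratio R v n.
Proof. by move=> uv; rewrite ler_wpM2r ?invr_ge0 ?ln_nat_ge0 ?ler_ln_nat. Qed.

Lemma log_ratio_mul u n : (1 < n)%N ->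
  log_ratio R u n * ln n%:R = ln (u n)%:R.
Proof. by move=> n1; rewrite /log_ratio mulfVK // gt_eqF // ln_nat_gt0. Qed.

(* A form of Fekete's lemma. *)
Lemma log_ratio_cvg_inf u : (forall n r, (n <= r)%N -> (u n <= u r)%N) ->
  (forall n m, (0 < n)%N -> (u (n ^ m.+1) <= u n ^ m.+1)%N) ->
  log_ratio R u @ \oo --> inf_ge2 (log_ratio R u).
Proof.
move=> u_mono u_exp; set b := inf_ge2 _.
apply/cvgrPdist_le => e e0.
have e2 : 0 < e / 2 by rewrite divr_gt0.
have [_ [n n1 <-] ltn] := inf_adherent e2 (has_inf_log_ratio R u).
rewrite -/(inf_ge2 _) -/b in ltn.
have /cvgrPdist_le /(_ _ e2) small := cst_div_ln_cvg0 (ln (u n)%:R).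
near=> q.
have q1 : (1 < q)%N by near: q; exists 2%N.
have lnq := ln_nat_gt0 q1; have lnn := ln_nat_gt0 n1.
have err : ln (u n)%:R / ln q%:R <= e / 2.
  have : `|0 - ln (u n)%:R / ln (q%:R : R)| <= e / 2 by near: q.
  by rewrite sub0r normrN ger0_norm // divr_ge0 ?ln_nat_ge0.
have bq := inf_ge2_le u q1; rewrite -/b in bq.
rewrite distrC ger0_norm ?subr_ge0 // lerBlDl.
have m_ln : (trunc_log n q)%:R * ln (n%:R : R) <= ln q%:R.
  by rewrite -ln_natX ?(ltnW n1) // ler_ln_nat // trunc_logP // ltnW.
(* As q < n^(t+1) for t the integer logarithm of q in base n, u(q) <= u(n)^(t+1). The one factor
   u(n) in excess is the error bounded by [err]. *)
have uq : ln (u q)%:R <= (trunc_log n q).+1%:R * ln ((u n)%:R : R).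
  apply: le_trans (ln_natX_le _ _); apply: ler_ln_nat.
  apply: leq_trans (u_exp _ _ (ltnW n1)); apply: u_mono.
  by rewrite ltnW // trunc_log_ltn.
apply: (@le_trans _ _ (log_ratio R u n + ln (u n)%:R / ln q%:R)); last first.
  by move: ltn err; rewrite [b + e](_ : _ = b + e / 2 + e / 2); [lra | field].
rewrite /log_ratio ler_pdivrMr // mulrDl divfK ?gt_eqF //.
apply: le_trans uq _; rewrite -natr1 mulrDl mul1r lerD2r.
rewrite -[X in _ * X](log_ratio_mul u n1) mulrCA ler_wpM2l //.
exact: log_ratio_ge0.
Unshelve. all: by end_near. Qed.

(** This performs the passage to large m: for y > 0 the linear term would outgrow the logarithm. *)
Lemma nat_linear_le_log (y c : R) :
  (forall m0 : nat, exists2 m : nat, (m0 <= m)%N & m%:R * y <= c + 2 * ln m.+1%:R) ->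
  y <= 0.
Proof.
move=> H; rewrite leNgt; apply/negP => y0.
have y4 : 0 < y / 4 by rewrite divr_gt0.
(* Applying ln x <= x at x = (y/4)(m+1) turns the hypothesis into m y / 2 <= c', which fails once m
   > 2 c' / y. *)
pose c' := c + y / 2 - 2 * ln (y / 4).
have [m m0 Hm] := H (Num.truncn (2 * c' / y)).+1.
have lnm : ln (m.+1%:R : R) <= y / 4 * m.+1%:R - ln (y / 4).
  by rewrite lerBrDl -lnM ?posrE ?ltr0n // ltW // ln_sublinear // mulr_gt0 ?ltr0n.
have : 2 * c' / y < m%:R.
  by apply: lt_le_trans (truncnS_gt _) _; rewrite ler_nat.
rewrite ltr_pdivrMr // /c'; move: (ln m.+1%:R) lnm Hm => l.
by rewrite -(natr1 m); lra.
Qed.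

End Logarithms.

(** * Comparison of the exponents with beta *)

Section Exponents.
Variables (R : realType) (k : nat).
Hypothesis k_gt0 : (0 < k)%N.

Lemma g_cvg_beta : log_ratio R (g_ k) @ \oo --> beta_ R k.
Proof.
apply: log_ratio_cvg_inf => [n r|n m n0]; first exact: g_mono.
exact: g_exp.
Qed.

(** For arbitrarily large m, |kA|^(m beta) <= p^beta <= g(p) <= C |A - A|^m (m+1)^2. After taking
    logarithms and dividing by m, the factor C (m+1)^2 disappears in the limit. *)
Lemma beta_le_ksumset (A : {fset int}) : (1 < #|` ksumset k A|)%N ->
  beta_ R k * ln (#|` ksumset k A|)%:R <= ln (#|` diffset A|)%:R.
Proof.
move=> q1; have [C C0 often] := g_le_infinitely_often k_gt0 q1.
rewrite -subr_le0; apply: (@nat_linear_le_log _ _ (ln C%:R)) => m0.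
have [m [p [m0m p1 qp gp]]] := often m0; exists m => //.
have beta0 : 0 <= beta_ R k by apply: le_inf_ge2 => n _; exact: log_ratio_ge0.
have bp : beta_ R k * ln p%:R <= ln (g_ k p)%:R.
  by rewrite -(log_ratio_mul R (g_ k) p1) ler_wpM2r ?ln_nat_ge0 ?inf_ge2_le.
have qm : m%:R * ln (#|` ksumset k A|)%:R <= ln p%:R :> R.
  by rewrite -ln_natX ?(ltnW q1) // ler_ln_nat.
have gC := le_trans (ler_ln_nat R gp) (ln_natM_le R _ _).
have DM := ln_natM_le R (#|` diffset A| ^ m) (m.+1 ^ 2).
have DX := ln_natX_le R #|` diffset A| m.
have mX := ln_natX_le R m.+1 2.
have bqm := ler_wpM2l beta0 qm.
by rewrite mulrBr mulrCA; lra.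
Qed.

Lemma beta_le_h (n : nat) : (1 < n)%N -> beta_ R k <= log_ratio R (h_ k) n.
Proof.
move=> n1; have [A [nA DA]] := h_attained n k_gt0.
rewrite /log_ratio ler_pdivlMr ?ln_nat_gt0 // -DA.
apply: le_trans (beta_le_ksumset (leq_trans n1 nA)).
rewrite ler_wpM2l ?ler_ln_nat //.
by apply: le_inf_ge2 => q _; exact: log_ratio_ge0.
Qed.

End Exponents.

Theorem theorem3 (R : realType) (k : nat) (k_gt0 : (0 < k)%N) :
  [/\ log_ratio R (f_ k) @ \oo --> beta_ R k,
      log_ratio R (g_ k) @ \oo --> beta_ R k,
      log_ratio R (h_ k) @ \oo --> beta_ R k
    & inf_ge2 (log_ratio R (h_ k)) = beta_ R k].
Proof.
have g_cvg : log_ratio R (g_ k) @ \oo --> beta_ R k by exact: g_cvg_beta.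
split => //.
(* Within the constant factor 2 k^2, f and g agree, so their log ratios differ by at most c / ln
   q. *)
- pose c : R := ln (2 * k ^ 2)%:R.
  have lower_cvg : log_ratio R (g_ k) q - c / ln q%:R @[q --> \oo] --> beta_ R k.
    by rewrite -[beta_ R k]subr0; apply: cvgB g_cvg (cst_div_ln_cvg0 c).
  apply: (squeeze_cvgr _ lower_cvg g_cvg); near=> q.
  have q1 : (1 < q)%N by near: q; exists 2%N.
  rewrite (le_log_ratio R (f_le_g k_gt0 q1)) andbT /log_ratio -mulrBl.
  rewrite ler_wpM2r ?invr_ge0 ?ln_nat_ge0 // lerBlDl.
  exact: le_trans (ler_ln_nat R (g_le_f k_gt0 q1)) (ln_natM_le R _ _).
(* The log ratio of h lies between the constant beta and that of g. *)
- apply: (squeeze_cvgr _ (cvg_cst (beta_ R k)) g_cvg); near=> q.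
  have q1 : (1 < q)%N by near: q; exists 2%N.
  by rewrite beta_le_h // le_log_ratio // h_le_g.
- apply/eqP; rewrite eq_le; apply/andP; split.
    apply: le_inf_ge2 => n n1; apply: le_trans (inf_ge2_le R (h_ k) n1) _.
    by rewrite le_log_ratio // h_le_g.
  by apply: le_inf_ge2 => n n1; exact: beta_le_h.
Unshelve. all: by end_near. Qed.
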